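(* Suppose that there exists a function $C:\mathcal{X}\times\mathcal{S}\to\mathbb{R}$ such that $p(s|\boldsymbol{x},y)=C(\boldsymbol{x},s)\,\boldsymbol{1}\{y\in s\}$ (the partial-label learning problem is proper). Let $\mathcal{D}_{\mathrm{PPL}}=\{(\boldsymbol{x}_i,s_i)\}_{i=1}^n$ be drawn independently from $p(\boldsymbol{x},s)$. Then, for every classifier $f:\mathcal{X}\to\mathbb{R}^K$ and loss function $\mathcal{L}$, $$\hat{R}_{\mathrm{PPL}}(f;\mathcal{L})=\frac{1}{n}\sum_{i=1}^n\sum_{j\in s_i}\frac{p(y=j|\boldsymbol{x}_i)}{\sum_{k\in s_i}p(y=k|\boldsymbol{x}_i)}\,\mathcal{L}(f(\boldsymbol{x}_i),j)$$ is an unbiased estimator of the classification risk $R(f;\mathcal{L})=\mathbb{E}_{p(\boldsymbol{x},y)}[\mathcal{L}(f(\boldsymbol{x}),y)]$; that is, the expectation of $\hat{R}_{\mathrm{PPL}}(f;\mathcal{L})$ over the draw of $\mathcal{D}_{\mathrm{PPL}}$ equals $R(f;\mathcal{L})$.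
   Context: Setting: $\mathcal{X}\subseteq\mathbb{R}^d$ is the instance space, $\mathcal{Y}=\{1,\dots,K\}$ with $K>2$ is the label space, and $\mathcal{S}=2^{\mathcal{Y}}\setminus\{\emptyset,\mathcal{Y}\}$ is the space of partial labels (candidate label sets). The random triple $(\boldsymbol{x},y,s)\in\mathcal{X}\times\mathcal{Y}\times\mathcal{S}$ has joint density $p(\boldsymbol{x},y,s)$ (with respect to Lebesgue measure in $\boldsymbol{x}$ and counting measure in $y,s$); $p(\boldsymbol{x},y)$, $p(\boldsymbol{x},s)$, $p(s|\boldsymbol{x},y)$, $p(y|\boldsymbol{x})$ etc. are the corresponding marginals and conditionals. Identities between conditional densities are understood for (almost) all values at which the conditioning density is positive. Standing assumption of partial-label learning: $P(y\in s\,|\,\boldsymbol{x},s)=1$. A loss function is a map $\mathcal{L}:\mathbb{R}^K\times\mathcal{Y}\to\mathbb{R}$; functions are measurable and the risk is assumed to be well defined (the expectation exists). *)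

(* Defs.v *)
(* The label space is {1, ..., K} = 'I_K with K = k.+3, so that K > 2 by typing
   and both 'I_K and the type of partial labels are visibly inhabited, as
   measurableType requires. *)
From HB Require Import structures.
From mathcomp Require Import all_boot all_order all_algebra.
From mathcomp Require Import all_classical all_reals all_analysis.
Set Implicit Arguments.
Unset Strict Implicit.
Unset Printing Implicit Defensive.
Import Order.TTheory GRing.Theory Num.Theory.
Local Open Scope classical_set_scope.
Local Open Scope ring_scope.

Section lebesgue_tuple.
Variable R : realType.

Definition tcons d (z : R * d.-tuple R) : d.+1.-tuple R :=
  [tuple of z.1 :: z.2].

Definition tuncons d (t : d.+1.-tuple R) : R * d.-tuple R :=
  (thead t, [tuple of behead t]).

Lemma tconsK d : cancel (@tcons d) (@tuncons d).
Proof. by move=> [a t]; congr (_, _); exact/val_inj. Qed.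

Lemma measurable_tcons d : measurable_fun setT (@tcons d).
Proof. exact: measurable_cons. Qed.

Lemma measurable_tuncons d : measurable_fun setT (@tuncons d).
Proof.
apply/measurable_fun_pair; first exact: measurable_tnth.
exact: measurable_behead.
Qed.

Section step.
Variables (d : nat) (nu : {sigma_finite_measure set (d.-tuple R) -> \bar R}).

Definition lebesgue_step : set (d.+1.-tuple R) -> \bar R :=
  pushforward (@lebesgue_measure R \x nu)%E (@tcons d).

Let lebesgue_step0 : lebesgue_step set0 = 0%E.
Proof. by apply: measure0; exact: measurable_tcons. Qed.

Let lebesgue_step_ge0 A : (0 <= lebesgue_step A)%E.
Proof. by apply: measure_ge0; exact: measurable_tcons. Qed.

Let lebesgue_step_sigma_additive : semi_sigma_additive lebesgue_step.
Proof. by apply: measure_semi_sigma_additive; exact: measurable_tcons. Qed.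

HB.instance Definition _ := isMeasure.Build _ _ _ lebesgue_step
  lebesgue_step0 lebesgue_step_ge0 lebesgue_step_sigma_additive.

Let lebesgue_step_sigma_finite : sigma_finite setT lebesgue_step.
Proof.
have /sigma_finiteP[F [TF ndF Foo]] := sigma_finiteT (@lebesgue_measure R).
have /sigma_finiteP[G [TG ndG Goo]] := sigma_finiteT nu.
exists (fun n => @tuncons d @^-1` (F n `*` G n)).
  rewrite -preimage_bigcup; apply/esym/seteqP; split=> // t _ /=.
  have [m _ Fm] : (\bigcup_n F n) (tuncons t).1 by rewrite -TF.
  have [n _ Gn] : (\bigcup_n G n) (tuncons t).2 by rewrite -TG.
  exists (maxn m n) => //; split.
  - by move: Fm; exact/subsetPset/ndF/leq_maxl.
  - by move: Gn; exact/subsetPset/ndG/leq_maxr.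
move=> n; have [mF Fn] := Foo n; have [mG Gn] := Goo n; split.
  rewrite -[X in measurable X]setTI; apply: measurable_tuncons => //.
  exact: measurableX.
rewrite /lebesgue_step /pushforward -comp_preimage.
rewrite (_ : _ \o _ = id) ?preimage_id; last first.
  by apply/funext => z /=; rewrite tconsK.
by rewrite product_measure1E// lte_mul_pinfty// ge0_fin_numE.
Qed.

HB.instance Definition _ := Measure_isSigmaFinite.Build _ _ _ lebesgue_step
  lebesgue_step_sigma_finite.

End step.

(* Lebesgue measure on R^d, as the d-fold product of the one-dimensional one. *)
Fixpoint lebesgue_tuple d : {sigma_finite_measure set (d.-tuple R) -> \bar R} :=
  match d with
  | 0 => \d_([tuple] : 0.-tuple R)
  | d'.+1 => lebesgue_step (lebesgue_tuple d')
  end.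

End lebesgue_tuple.
Arguments lebesgue_tuple : clear implicits.

Lemma lebesgue_tuple_box (R : realType) d (A : 'I_d -> set R) :
  (forall i, measurable (A i)) ->
  lebesgue_tuple R d [set t | forall i, A i (tnth t i)] =
  (\prod_(i < d) @lebesgue_measure R (A i))%E.
Proof.
elim: d A => [|d IH] A mA.
  rewrite big_ord0 /= diracE (_ : _ \in _)// inE; by case.
rewrite big_ord_recl /= /lebesgue_step /pushforward -IH//.
have mB : measurable [set t : d.-tuple R | forall i, A (lift ord0 i) (tnth t i)].
  rewrite (_ : [set _ | _] = \bigcap_(i in [set: 'I_d]) ((fun t => tnth t i) @^-1` A (lift ord0 i))).
    apply: fin_bigcap_measurable; first exact: finite_finset.
    by move=> i _; rewrite -[X in measurable X]setTI; exact: measurable_tnth.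
  by apply/seteqP; split=> [t h i _|t h i] /=; [exact: h|exact: (h i I)].
rewrite -product_measure1E; [|exact: mA|exact: mB]; congr (product_measure1 _ _ _).
apply/seteqP; split=> -[a t] /=.
  move=> h; split; first exact: (h ord0).
  by move=> i; have := h (lift ord0 i); rewrite tnthS.
move=> [h0 h] i; case: (unliftP ord0 i) => [j ->|->]//.
by rewrite tnthS.
Qed.

#[short(type="finMeasurableType")]
HB.structure Definition FinMeasurable d := {T of Measurable d T & Finite T}.

HB.instance Definition _ d1 d2 (T1 : finMeasurableType d1)
  (T2 : finMeasurableType d2) := Finite.on (T1 * T2)%type.

Section fin_counting.
Context d (T : finMeasurableType d) (R : realType).

Definition fin_counting : set T -> \bar R := counting.

HB.instance Definition _ := Measure.on fin_counting.

Let fin_counting_sigma_finite : sigma_finite setT fin_counting.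
Proof.
exists (fun=> setT); first by rewrite bigcup_const.
move=> _; split=> //.
by rewrite /fin_counting /counting asboolT ?ltry//; exact: finite_finset.
Qed.

HB.instance Definition _ := Measure_isSigmaFinite.Build _ _ _ fin_counting
  fin_counting_sigma_finite.

End fin_counting.
Arguments fin_counting {d} T R.

HB.instance Definition _ n := isPointed.Build 'I_n.+1 ord0.
HB.instance Definition _ n := @isMeasurable.Build default_measure_display
  'I_n.+1 discrete_measurable discrete_measurable0
  discrete_measurableC discrete_measurableU.

Definition is_plabel k : pred {set 'I_k.+3} :=
  fun s => (s != finset.set0) && (s != [set: 'I_k.+3]%SET).

Definition plabel k := {s : {set 'I_k.+3} | is_plabel s}.

Section plabel.
Variable k : nat.

Lemma is_plabel_ord0 : is_plabel ([set ord0]%SET : {set 'I_k.+3}).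
Proof.
apply/andP; split; first by apply/set0Pn; exists ord0; rewrite finset.in_set1.
by apply/eqP => /setP /(_ ord_max); rewrite finset.in_set1 finset.in_setT.
Qed.

HB.instance Definition _ := Finite.on (plabel k).
HB.instance Definition _ :=
  isPointed.Build (plabel k) (exist _ [set ord0]%SET is_plabel_ord0).
HB.instance Definition _ := @isMeasurable.Build default_measure_display
  (plabel k) discrete_measurable discrete_measurable0
  discrete_measurableC discrete_measurableU.

End plabel.

Section densities.
Context d (Om : measurableType d) (R : realType) (P : probability Om R) (m : nat).

(* Z takes its values in X x T and has density p there, with respect to Lebesgue
   measure on R^m times counting measure on T; p is unconstrained off X. *)
Definition has_density d' (T : finMeasurableType d') (X : set (m.-tuple R))
    (p : m.-tuple R -> T -> R) (Z : {RV P >-> (m.-tuple R * T)%type}) : Prop :=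
  let D := [set z : m.-tuple R * T | X z.1] in
  [/\ forall w, D (Z w),
      measurable_fun D (fun z => p z.1 z.2),
      forall x t, X x -> 0 <= p x t &
      forall B : set (m.-tuple R * T), measurable B ->
        P (Z @^-1` B) =
        (\int[lebesgue_tuple R m \x fin_counting T R]_(z in D `&` B)
          (p z.1 z.2)%:E)%E].

(* Finite subfamilies are covered by taking some A i to be setT. *)
Definition mutually_independent d' (T : measurableType d') n
    (Z : 'I_n -> {RV P >-> T}) : Prop :=
  forall A : 'I_n -> set T, (forall i, measurable (A i)) ->
    P (\bigcap_(i in [set: 'I_n]) (Z i @^-1` A i)) =
    (\prod_(i < n) P (Z i @^-1` A i))%E.

(* The expectation exists in the extended sense: it may be infinite, but it is
   not of the form oo - oo. *)
Definition has_expectation (Y : Om -> R) : Prop :=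
  measurable_fun setT Y /\
  (\int[P]_w ((EFin \o Y)^\+ w) < +oo \/ \int[P]_w ((EFin \o Y)^\- w) < +oo)%E.

Definition unbiased_estimator (Y : Om -> R) (theta : \bar R) : Prop :=
  has_expectation Y /\ 'E_P[Y]%E = theta.

End densities.

Section partial_label_learning.
Variables (R : realType) (m k : nat).
Implicit Types (X : set (m.-tuple R)) (x : m.-tuple R) (y : 'I_k.+3)
  (s : plabel k) (p : m.-tuple R -> 'I_k.+3 * plabel k -> R).

Definition p_xy p x y : R := \sum_(s : plabel k) p x (y, s).
Definition p_xs p x s : R := \sum_(y : 'I_k.+3) p x (y, s).
Definition p_x p x : R := \sum_(y : 'I_k.+3) \sum_(s : plabel k) p x (y, s).
Definition p_s_given_xy p x y s : R := p x (y, s) / p_xy p x y.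
Definition p_y_given_x p x y : R := p_xy p x y / p_x p x.
Definition p_y_given_xs p x s y : R := p x (y, s) / p_xs p x s.

Definition candidate_contains_label X p : Prop :=
  {ae lebesgue_tuple R m, forall x, X x -> forall s, 0 < p_xs p x s ->
    \sum_(y in val s) p_y_given_xs p x s y = 1}.

Definition proper_ppl X p : Prop :=
  exists C : m.-tuple R -> plabel k -> R,
    {ae lebesgue_tuple R m, forall x, X x -> forall y s, 0 < p_xy p x y ->
      p_s_given_xy p x y s = C x s * (y \in val s)%:R}.

(* The quotient is x / 0 = 0 where the candidate labels have total mass 0,
   an event of probability 0 under p_xs in the proper case. *)
Definition ppl_loss p (f : m.-tuple R -> k.+3.-tuple R)
    (L : k.+3.-tuple R -> 'I_k.+3 -> R) x s : R :=
  \sum_(j in val s)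
    p_y_given_x p x j / (\sum_(l in val s) p_y_given_x p x l) * L (f x) j.

Definition ppl_risk_estimator p (f : m.-tuple R -> k.+3.-tuple R)
    (L : k.+3.-tuple R -> 'I_k.+3 -> R) n (D : 'I_n -> m.-tuple R * plabel k) : R :=
  n%:R^-1 * \sum_(i < n) ppl_loss p f L (D i).1 (D i).2.

End partial_label_learning.

(* Main.v *)
(* In a proper problem p(x, y, s) = C(x, s) p(x, y) 1{y in s}, hence
   p(x, s) = C(x, s) sum_(l in s) p(x, l): the posterior weight of j in the
   estimator, multiplied by p(x, s), is p(x, j, s).  Summing over s and
   integrating over x gives the claim for nonnegative losses by Tonelli.  The risk
   may be infinite, so a general loss L is handled by applying this to L^+ and L^-
   separately; at least one of the two resulting expectations is finite. *)
Require Import Defs.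
From HB Require Import structures.
From mathcomp Require Import all_boot all_order all_algebra.
From mathcomp Require Import all_classical all_reals all_analysis.
From mathcomp Require Import measurable_realfun ring.
Set Implicit Arguments.
Unset Strict Implicit.
Unset Printing Implicit Defensive.
Import Order.TTheory GRing.Theory Num.Theory.
Local Open Scope classical_set_scope.
Local Open Scope ring_scope.

(** * Measurability on cylinders [X * setT] *)

Lemma measurable_preimage_fst d1 (U1 : measurableType d1) d2
    (U2 : measurableType d2) (X : set U1) :
  measurable X -> measurable [set z : U1 * U2 | X z.1].
Proof.
move=> mX; rewrite (_ : [set z | _] = X `*` setT); first exact: measurableX.
by apply/seteqP; split => z //= [].
Qed.

Lemma measurable_fun_fst_restrict d1 (U1 : measurableType d1) d2
    (U2 : measurableType d2) d3 (V : measurableType d3) (X : set U1) (g : U1 -> V) :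
  measurable X -> measurable_fun X g ->
  measurable_fun [set z : U1 * U2 | X z.1] (g \o fst).
Proof.
move=> mX mg; apply: (measurable_comp mX) => //; first by move=> _ [z Xz <-].
by apply: measurable_funTS; exact: measurable_fst.
Qed.

(** * Integration against a density and against counting measure *)

Section density.
Local Open Scope ereal_scope.
Import HBNNSimple.

(** Increasing simple approximations of [f] reduce the claim, by monotone convergence on both sides,
    to indicators, for which it is the assumed formula for [nu]. *)
Lemma ge0_integral_density d (U : measurableType d) (R : realType)
    (mu nu : {measure set U -> \bar R}) (D : set U) (q : U -> R)
    (f : U -> \bar R) :
  measurable D -> measurable_fun D q -> (forall x, D x -> (0 <= q x)%R) ->
  (forall B, measurable B -> nu B = \int[mu]_(x in D `&` B) (q x)%:E) ->
  measurable_fun D f -> (forall x, D x -> 0 <= f x) ->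
  \int[nu]_(x in D) f x = \int[mu]_(x in D) (f x * (q x)%:E).
Proof.
move=> mD mq q0 nuE mf f0; have /measurable_EFinP mEq := mq.
pose h := nnsfun_approx mD mf.
have mh n : measurable_fun D (EFin \o h n).
  exact/measurable_funTS/measurable_EFinP.
have ndh x : D x -> {homo (fun n => (EFin \o h n) x) : a b / (a <= b)%N >-> a <= b}.
  by move=> _ a b ab; rewrite lee_fin; exact/lefP/nd_nnsfun_approx.
have fE x : D x -> f x = limn (fun n => (EFin \o h n) x).
  by move=> Dx; apply/esym/cvg_lim => //; exact: cvg_nnsfun_approx.
have fqE x : D x -> f x * (q x)%:E = limn (fun n => (EFin \o h n) x * (q x)%:E).
  move=> Dx; apply/esym/cvg_lim => //.
  by apply: cvgeZr => //; exact: cvg_nnsfun_approx.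
under eq_integral => x /[!inE] /fE -> //.
under [RHS]eq_integral => x /[!inE] /fqE -> //.
rewrite !monotone_convergence//; last 4 first.
- by move=> n; exact: emeasurable_funM.
- by move=> n x Dx /=; rewrite mule_ge0 ?lee_fin ?q0.
- by move=> x Dx a b ab /=; rewrite lee_wpmul2r ?lee_fin ?q0//; exact: ndh.
- by move=> n x Dx /=; rewrite lee_fin.
congr (limn _); apply/funext => n.
have mi r : measurable_fun D (fun x => (r * \1_(h n @^-1` [set r]) x)%:E).
  by apply: (measurable_comp measurableT) => //; exact: measurable_funM.
(* This holds for every real [r]: as [h n] is nonnegative, a negative [r] has an empty fibre. *)
have i0 r x : 0 <= (r * \1_(h n @^-1` [set r]) x)%:E.
  by rewrite EFinM nnfun_muleindic_ge0.
under eq_integral do rewrite /= fimfunE -fsumEFin//.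
under [RHS]eq_integral.
  move=> x _; rewrite /= fimfunE -fsumEFin// ge0_mule_fsuml//.
  over.
rewrite !ge0_integral_fsum//; last 2 first.
- by move=> r; exact: emeasurable_funM.
- by move=> r x Dx; apply: mule_ge0 => //; rewrite lee_fin q0.
apply: eq_fsbigr => r; rewrite inE => -[x _ <-].
rewrite integralZl_indic_nnsfun// integral_indic//.
under [RHS]eq_integral do rewrite EFinM -muleA.
rewrite ge0_integralZl//; last 3 first.
- by apply: emeasurable_funM => //; exact/measurable_EFinP.
- by move=> y Dy; rewrite mule_ge0 ?lee_fin ?q0.
- by rewrite lee_fin.
congr (_ * _); under eq_integral do rewrite muleC.
rewrite nuE; last exact: measurableI.
rewrite setIC -setIA setIid setIC integral_mkcondr.
by apply: eq_integral => y _; rewrite epatch_indic.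
Qed.

Lemma fin_countingE d (T : finMeasurableType d) (R : realType) (A : set T) :
  fin_counting T R A = \sum_(t : T) \d_t A.
Proof.
rewrite /fin_counting /counting asboolT; last exact: finite_finset.
rewrite -(card_uniqP (finmap.fset_uniq _)) -sum1_card
  big_mkcond/= natr_sum -sumEFin.
apply: eq_bigr => t _; rewrite diracE in_fset_set; last exact: finite_finset.
by case: (t \in A).
Qed.

(** Counting measure on a finite type is a finite sum of Dirac masses, and integrating against a
    Dirac mass is evaluation. The sigma-algebra of [T] need not be discrete, hence the measurability
    hypothesis. *)
Lemma ge0_integral_fin_counting d (T : finMeasurableType d) (R : realType)
    (f : T -> \bar R) :
  measurable_fun setT f -> (forall t, 0 <= f t) ->
  \int[fin_counting T R]_t f t = \sum_(t : T) f t.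
Proof.
move=> mf f0.
(* [msum] takes a sequence of measures, so the elements of [T] are enumerated by naturals; the
   default [point] lies beyond the range that is summed. *)
pose m_ n : {measure set T -> \bar R} := \d_(nth point (index_enum T) n).
rewrite (@eq_measure_integral _ _ _ _ (msum m_ (size (index_enum T)))); last first.
  move=> A _ _; apply: etrans (fin_countingE _ _) _.
  by rewrite /msum (big_nth point) big_mkord.
rewrite ge0_integral_measure_sum// [RHS](big_nth point) big_mkord.
by apply: eq_bigr => n _; rewrite integral_dirac// diracT mul1e.
Qed.

(** The expectation is moved to the law of [Z], which lives on the cylinder over [X]; there the
    density is inserted, and Tonelli turns the product integral into an integral over [x] of a
    finite sum over [t]. *)
Lemma ge0_integral_has_density d (Om : measurableType d) (R : realType)
    (P : probability Om R) m d' (T : finMeasurableType d') (X : set (m.-tuple R))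
    (p : m.-tuple R -> T -> R) (Z : {RV P >-> (m.-tuple R * T)%type})
    (h : m.-tuple R -> T -> R) :
  measurable X -> has_density X p Z ->
  measurable_fun [set z : m.-tuple R * T | X z.1] (fun z => h z.1 z.2) ->
  (forall x t, X x -> (0 <= h x t)%R) ->
  \int[P]_w (h (Z w).1 (Z w).2)%:E =
  \int[lebesgue_tuple R m]_(x in X) (\sum_(t : T) h x t * p x t)%R%:E.
Proof.
move=> mX [ZD mp p0 PZ] mh h0; pose D := [set z : m.-tuple R * T | X z.1].
have mD : measurable D by exact: measurable_preimage_fst.
have -> : \int[P]_w (h (Z w).1 (Z w).2)%:E =
    \int[distribution P Z]_(z in D) (h z.1 z.2)%:E.
  rewrite /distribution ge0_integral_pushforward//.
  - by rewrite (_ : Z @^-1` D = setT)//; apply/seteqP; split => // w _; exact: ZD.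
  - exact/measurable_EFinP.
  - by move=> z /[!inE] Dz; rewrite lee_fin h0.
rewrite (@ge0_integral_density _ _ _ (lebesgue_tuple R m \x fin_counting T R)
  _ _ (fun z => p z.1 z.2))//; last 3 first.
- by move=> z; exact: p0.
- exact/measurable_EFinP.
- by move=> z; rewrite lee_fin; exact: h0.
under eq_integral do rewrite -EFinM.
(* Tonelli is applied on the whole product space, so the integrand is extended by 0 outside [D],
   where the signs of [h] and [p] are unknown. *)
set g := fun z => _%:E; rewrite integral_mkcond.
have mg : measurable_fun setT (g \_ D).
  apply/(measurable_restrict _ mD) => //; rewrite setTI; apply/measurable_EFinP.
  exact: measurable_funM.
have g0 z : 0 <= (g \_ D) z.
  by apply: erestrict_ge0 => -[x t] Dz; rewrite lee_fin mulr_ge0 ?h0 ?p0.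
rewrite fubini_tonelli1// [RHS]integral_mkcond; apply: eq_integral => x _.
rewrite /fubini_F ge0_integral_fin_counting//; last exact: measurableT_comp.
rewrite /patch; case: ifPn => xX.
  rewrite -sumEFin; apply: eq_bigr => t _; rewrite ifT//.
by apply: big1 => t _; rewrite ifN//.
Qed.

End density.

(** * Expectation of a difference of nonnegative variables *)

Section difference.
Local Open Scope ereal_scope.

(** The variables [a] and [b] may overlap, so they need not be the positive and negative parts of
    [Y]. They do dominate these parts, which transfers finiteness, and integrating
    [Y^+ + b = Y^- + a] avoids any subtraction of infinities. *)
Lemma unbiased_estimatorB d (Om : measurableType d) (R : realType)
    (P : probability Om R) (a b : Om -> R) :
  measurable_fun setT a -> measurable_fun setT b ->
  (forall w, (0 <= a w)%R) -> (forall w, (0 <= b w)%R) ->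
  \int[P]_w (a w)%:E < +oo \/ \int[P]_w (b w)%:E < +oo ->
  unbiased_estimator P (a \- b)%R (\int[P]_w (a w)%:E - \int[P]_w (b w)%:E).
Proof.
move=> ma mb a0 b0 ab; set Y := (a \- b)%R.
have mY : measurable_fun setT Y by exact: measurable_funB.
have mYp : measurable_fun setT (EFin \o Y^\+)%R.
  exact/measurable_EFinP/measurable_funrpos.
have mYn : measurable_fun setT (EFin \o Y^\-)%R.
  exact/measurable_EFinP/measurable_funrneg.
have Yp0 w : 0 <= (EFin \o Y^\+)%R w by rewrite lee_fin funrpos_ge0.
have Yn0 w : 0 <= (EFin \o Y^\-)%R w by rewrite lee_fin funrneg_ge0.
have Ea0 : 0 <= \int[P]_w (a w)%:E.
  by apply: integral_ge0 => w _; rewrite lee_fin.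
have Eb0 : 0 <= \int[P]_w (b w)%:E.
  by apply: integral_ge0 => w _; rewrite lee_fin.
have EYp0 : 0 <= \int[P]_w (EFin \o Y^\+)%R w by exact: integral_ge0.
have EYn0 : 0 <= \int[P]_w (EFin \o Y^\-)%R w by exact: integral_ge0.
have mea : measurable_fun setT (EFin \o a) by exact/measurable_EFinP.
have meb : measurable_fun setT (EFin \o b) by exact/measurable_EFinP.
have Yp_a : \int[P]_w (EFin \o Y^\+)%R w <= \int[P]_w (a w)%:E.
  apply: ge0_le_integral => // w _.
  by rewrite /= lee_fin /funrpos /Y ge_max a0 lerBlDr lerDl b0.
have Yn_b : \int[P]_w (EFin \o Y^\-)%R w <= \int[P]_w (b w)%:E.
  apply: ge0_le_integral => // w _.
  by rewrite /= lee_fin /funrneg /Y ge_max b0 opprB lerBlDr lerDl a0.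
have YabE : \int[P]_w (EFin \o Y^\+)%R w + \int[P]_w (b w)%:E =
            \int[P]_w (EFin \o Y^\-)%R w + \int[P]_w (a w)%:E.
  rewrite -!ge0_integralD//; last 2 first.
  - by move=> w _; rewrite lee_fin.
  - by move=> w _; rewrite lee_fin.
  apply: eq_integral => w _; rewrite -!EFinD; congr (_%:E).
  (* Both sides are the maximum of [a w] and [b w]. *)
  by rewrite /funrpos /funrneg /Y /= !addr_maxl opprB !subrK !add0r maxC.
rewrite /unbiased_estimator [X in _ /\ X = _](_ : _ = \int[P]_w (EFin \o Y^\+)%R w -
    \int[P]_w (EFin \o Y^\-)%R w); last first.
  by rewrite expectation.unlock integralE -funerpos -funerneg.
rewrite /has_expectation funerpos funerneg; split; first split => //.
  by case: ab => [/(le_lt_trans Yp_a)|/(le_lt_trans Yn_b)]; [left|right].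
(* If one of the four integrals is infinite, either a hypothesis fails or both sides are the same
   infinity; what remains is the case of four real numbers. *)
move: YabE Yp_a Yn_b ab Ea0 Eb0 EYp0 EYn0.
case: (\int[P]_w (EFin \o Y^\+)%R w) => [yp| |];
case: (\int[P]_w (EFin \o Y^\-)%R w) => [yn| |];
case: (\int[P]_w (a w)%:E) => [ia| |];
case: (\int[P]_w (b w)%:E) => [ib| |] //=; rewrite ?ltxx.
all: try by move=> _ _ _ [].
move=> [e] _ _ _ _ _ _ _; rewrite -!EFinB; congr (_%:E).
by apply/eqP; rewrite subr_eq addrAC eq_sym subr_eq addrC -e addrC.
Qed.

End difference.

(** * Measurability of the posterior weights and of the losses *)

Lemma measurable_inv (R : realType) : measurable_fun setT (@GRing.inv R).
Proof.
(* Inversion is continuous on the open set of nonzero reals; the point 0 is a measurable singleton,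
   treated apart. *)
rewrite (_ : setT = [set 0 : R] `|` [set x | x != 0]); last first.
  by apply/seteqP; split => // x _ /=; case: (eqVneq x 0) => [->|]; [left|right].
apply/measurable_funU => //; first by apply: open_measurable; exact: open_neq.
split; first exact: measurable_fun_set1.
apply: open_continuous_measurable_fun; first exact: open_neq.
by move=> x /[!inE] /= x0; exact: inv_continuous.
Qed.

(* A finite type need not carry the discrete sigma-algebra here, hence [mT]. *)
Lemma measurable_fun_fin_case d (U : measurableType d) d' (T : finMeasurableType d')
    d'' (V : measurableType d'') (D : set U) (Z : U -> T) (F : U -> T -> V) :
  (forall t : T, measurable [set t]) -> measurable_fun D Z ->
  (forall t, measurable_fun D (F ^~ t)) -> measurable_fun D (fun w => F w (Z w)).
Proof.
move=> mT mZ mF mD B mB.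
(* The preimage of [B] is cut along the finitely many values [t] of [Z]; on each piece the function
   is [F ^~ t]. *)
rewrite (_ : _ `&` _ = \bigcup_(t in setT)
    ((D `&` Z @^-1` [set t]) `&` (D `&` (F ^~ t) @^-1` B))).
  apply: fin_bigcup_measurable; first exact: finite_finset.
  by move=> t _; apply: measurableI; [exact: mZ|exact: mF].
apply/seteqP; split => w /=; first by move=> [Dw FB]; exists (Z w).
by move=> [t _ [[Dw <-] [_ FB]]].
Qed.

Section measurability.
Variables (R : realType) (m k : nat) (X : set (m.-tuple R)).
Variables (p : m.-tuple R -> 'I_k.+3 * plabel k -> R).
Hypothesis mX : measurable X.
Hypothesis mp : measurable_fun
  [set z : m.-tuple R * ('I_k.+3 * plabel k) | X z.1] (fun z => p z.1 z.2).

Lemma measurable_density_slice t : measurable_fun X (p ^~ t).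
Proof.
apply: (@measurable_comp _ _ _ _ _ _ [set z | X z.1] (fun z => p z.1 z.2) _
    (fun x => (x, t))) => //.
- exact: measurable_preimage_fst.
- by move=> _ [x Xx <-].
- exact/measurable_funTS/pair2_measurable.
Qed.

Lemma measurable_p_xy y : measurable_fun X (p_xy p ^~ y).
Proof. by apply: measurable_sum => s; exact: measurable_density_slice. Qed.

Lemma measurable_p_xs s : measurable_fun X (p_xs p ^~ s).
Proof. by apply: measurable_sum => y; exact: measurable_density_slice. Qed.

Lemma measurable_p_y_given_x y : measurable_fun X (p_y_given_x p ^~ y).
Proof.
apply: measurable_funM; first exact: measurable_p_xy.
apply: (measurableT_comp (@measurable_inv R)).
by apply: measurable_sum => j; exact: measurable_p_xy.
Qed.

Variables (f : m.-tuple R -> k.+3.-tuple R) (L : k.+3.-tuple R -> 'I_k.+3 -> R).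
Hypothesis mf : measurable_fun X f.
Hypothesis mL : forall y, measurable_fun setT (L ^~ y).

Lemma measurable_loss y : measurable_fun X (fun x => L (f x) y).
Proof. exact: (measurableT_comp (mL y)). Qed.

Lemma measurable_ppl_loss s : measurable_fun X (ppl_loss p f L ^~ s).
Proof.
rewrite /ppl_loss; under eq_fun do rewrite big_mkcond/=.
apply: measurable_sum => j; case: (j \in val s) => //=.
apply: measurable_funM; last exact: measurable_loss.
apply: measurable_funM; first exact: measurable_p_y_given_x.
apply: (measurableT_comp (@measurable_inv R)).
under eq_fun do rewrite big_mkcond/=.
apply: measurable_sum => l; case: (l \in val s) => //=.
exact: measurable_p_y_given_x.
Qed.

(** The label coordinate takes finitely many values, so measurability in [x] for each fixed label
    suffices. *)
Lemma measurable_loss_joint :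
  measurable_fun [set z : m.-tuple R * ('I_k.+3 * plabel k) | X z.1]
    (fun z => L (f z.1) z.2.1).
Proof.
apply: (@measurable_fun_fin_case _ _ _ _ _ _ _ (fun z => z.2.1)
  (fun z y => L (f z.1) y)) => //.
  apply/measurable_funTS; apply: (@measurableT_comp _ _ _ _ _ _ fst _ snd).
    exact: measurable_fst.
  exact: measurable_snd.
by move=> y; exact: (measurable_fun_fst_restrict mX (measurable_loss y)).
Qed.

Lemma measurable_ppl_loss_joint :
  measurable_fun [set z : m.-tuple R * plabel k | X z.1]
    (fun z => ppl_loss p f L z.1 z.2).
Proof.
apply: (@measurable_fun_fin_case _ _ _ _ _ _ _ snd
  (fun z s => ppl_loss p f L z.1 s)) => //.
  by apply: measurable_funTS; exact: measurable_snd.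
by move=> s; exact: (measurable_fun_fst_restrict mX (measurable_ppl_loss s)).
Qed.

End measurability.

(** * The identity at a fixed instance *)

(** Here [x] is fixed and [C] is the slice at [x] of the function given by properness. The two sides
    agree already for each [s] and each label: [p_x] cancels inside the weight, and the mass of the
    candidate set cancels against [p_xs]. *)
Lemma sum_ppl_lossM (R : realType) m k (p : m.-tuple R -> 'I_k.+3 * plabel k -> R)
    (f : m.-tuple R -> k.+3.-tuple R) (L : k.+3.-tuple R -> 'I_k.+3 -> R)
    (C : plabel k -> R) x :
  (forall t, 0 <= p x t) ->
  (forall y s, 0 < p_xy p x y ->
    p_s_given_xy p x y s = C s * (y \in val s)%:R) ->
  \sum_s ppl_loss p f L x s * p_xs p x s = \sum_t L (f x) t.1 * p x t.
Proof.
move=> p0 pC.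
have q0 y : 0 <= p_xy p x y by exact: sumr_ge0.
have pE y s : p x (y, s) = p_xy p x y * (C s * (y \in val s)%:R).
  (* Properness is silent where [p_xy p x y] vanishes, but there every nonnegative summand
     [p x (y, s)] vanishes too. *)
  have := q0 y; rewrite le_eqVlt => /predU1P[q_eq0|q_gt0].
    rewrite -q_eq0 mul0r; exact: (@psumr_eq0P _ _ predT (fun s => p x (y, s))).
  by rewrite -pC// /p_s_given_xy mulrCA divff ?mulr1// gt_eqF.
have pxsE s : p_xs p x s = C s * \sum_(y in val s) p_xy p x y.
  rewrite /p_xs mulr_sumr [RHS]big_mkcond/=; apply: eq_bigr => y _.
  by rewrite pE; case: ifP => _; rewrite ?mulr1 ?mulr0// mulrC.
have -> : \sum_t L (f x) t.1 * p x t = \sum_s \sum_y L (f x) y * p x (y, s).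
  by rewrite exchange_big pair_bigA; apply: eq_bigr => -[].
apply: eq_bigr => s _; rewrite mulr_suml [LHS]big_mkcond/=.
apply: eq_bigr => j _; rewrite pE; case: ifPn => js; last by rewrite !mulr0.
rewrite pxsE mulr1 /p_y_given_x -mulr_suml.
(* If the candidate labels have mass 0, the weight is a quotient by 0; since [j] is one of them,
   [p_xy p x j] is 0 and both sides vanish. *)
have [b0|b0] := eqVneq (\sum_(l in val s) p_xy p x l) 0.
  rewrite (@psumr_eq0P _ _ (mem (val s)) (fun l => p_xy p x l))//.
  by rewrite !mul0r mulr0.
have px0 : p_x p x != 0.
  apply: contra_neq b0 => px0; apply: big1 => l _.
  exact: (@psumr_eq0P _ _ predT (fun l => p_xy p x l)).
by field; rewrite b0 px0.
Qed.

(** * Nonnegative losses, with expectations possibly infinite *)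

Section nonnegative_loss.
Local Open Scope ereal_scope.
Variables (R : realType) (m k : nat).
Variables (X : set (m.-tuple R)) (p : m.-tuple R -> 'I_k.+3 * plabel k -> R).
Variables (d0 : measure_display) (Om0 : measurableType d0)
  (P0 : probability Om0 R)
  (T : {RV P0 >-> (m.-tuple R * ('I_k.+3 * plabel k))%type}).
Variables (d : measure_display) (Om : measurableType d) (P : probability Om R).
Variables (f : m.-tuple R -> k.+3.-tuple R) (L : k.+3.-tuple R -> 'I_k.+3 -> R).
Hypotheses (mX : measurable X) (dT : has_density X p T) (hp : proper_ppl X p).
Hypothesis mf : measurable_fun X f.
Hypothesis mL : forall y, measurable_fun setT (L ^~ y).

(** Measurability over [X] is enough because [has_density] keeps every value of [Z] in the cylinder
    over [X]. *)
Lemma measurable_ppl_lossT (Z : {RV P >-> (m.-tuple R * plabel k)%type}) :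
  has_density X (p_xs p) Z ->
  measurable_fun setT (fun w => ppl_loss p f L (Z w).1 (Z w).2).
Proof.
move=> [ZX _ _ _]; have [_ mp _ _] := dT.
apply: (@measurable_comp _ _ _ _ _ _ [set z | X z.1]
  (fun z => ppl_loss p f L z.1 z.2) _ Z) => //.
- exact: measurable_preimage_fst.
- by move=> _ [w _ <-]; exact: ZX.
- exact: measurable_ppl_loss_joint.
Qed.

Hypothesis L0 : forall v y, (0 <= L v y)%R.

Lemma ppl_loss_ge0 x s : X x -> (0 <= ppl_loss p f L x s)%R.
Proof.
move=> Xx; have [_ _ p0 _] := dT.
have q0 y : (0 <= p_y_given_x p x y)%R.
  rewrite divr_ge0//; first by apply: sumr_ge0 => *; exact: p0.
  by do 2 apply: sumr_ge0 => ? _; exact: p0.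
by apply: sumr_ge0 => j _; rewrite mulr_ge0// divr_ge0// sumr_ge0.
Qed.

Lemma ge0_expectation_ppl_loss (Z : {RV P >-> (m.-tuple R * plabel k)%type}) :
  has_density X (p_xs p) Z ->
  \int[P]_w (ppl_loss p f L (Z w).1 (Z w).2)%:E =
  \int[P0]_w (L (f (T w).1) (T w).2.1)%:E.
Proof.
move=> dZ; have [_ mp p0 _] := dT; have [_ _ pxs0 _] := dZ.
rewrite (ge0_integral_has_density (h := ppl_loss p f L) mX dZ); last 2 first.
- exact: measurable_ppl_loss_joint.
- by move=> x s Xx; exact: ppl_loss_ge0.
rewrite (ge0_integral_has_density (h := fun x t => L (f x) t.1) mX dT)//;
  last exact: (measurable_loss_joint mX mf mL).
have [C hC] := hp.
(* Both expectations are now integrals over [X]; their integrands agree wherever properness holds,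
   that is almost everywhere. *)
apply: ge0_ae_eq_integral => //.
- apply/measurable_EFinP; apply: measurable_sum => s.
  by apply: measurable_funM; [exact: measurable_ppl_loss|exact: measurable_p_xs].
- apply/measurable_EFinP; apply: measurable_sum => t.
  by apply: measurable_funM; [exact: measurable_loss|exact: measurable_density_slice].
- move=> x Xx; rewrite lee_fin sumr_ge0// => s _.
  by rewrite mulr_ge0 ?ppl_loss_ge0 ?pxs0.
- by move=> x Xx; rewrite lee_fin sumr_ge0// => t _; rewrite mulr_ge0// p0.
- apply: filterS hC => x hCx Xx; congr (_%:E).
  by apply: (@sum_ppl_lossM _ _ _ _ _ _ (C x)) => [t|]; [exact: p0|exact: hCx].
Qed.

Variables (n : nat) (D : 'I_n -> {RV P >-> (m.-tuple R * plabel k)%type}).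
Hypothesis dD : forall i, has_density X (p_xs p) (D i).

Lemma ge0_expectation_ppl_risk_estimator : (0 < n)%N ->
  \int[P]_w (ppl_risk_estimator p f L (fun i => D i w))%:E =
  \int[P0]_w (L (f (T w).1) (T w).2.1)%:E.
Proof.
move=> n0; rewrite /ppl_risk_estimator.
have l0 i w : 0 <= (ppl_loss p f L (D i w).1 (D i w).2)%:E.
  by have [DX _ _ _] := dD i; rewrite lee_fin ppl_loss_ge0//; exact: DX.
have ml i : measurable_fun setT (fun w => (ppl_loss p f L (D i w).1 (D i w).2)%:E).
  exact/measurable_EFinP/measurable_ppl_lossT.
under eq_integral do rewrite EFinM -sumEFin.
rewrite ge0_integralZl//; last 2 first.
- exact: emeasurable_sum.
- by move=> w _; exact: sume_ge0.
rewrite ge0_integral_sum//.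
under eq_bigr do rewrite ge0_expectation_ppl_loss//.
rewrite sumr_const card_ord.
(* The sum of [n] equal terms becomes a product by [n], and associativity cancels [n] even when the
   common expectation is [+oo]. *)
rewrite -[X in _ * X]/(_ *+ n)%E -mule_natl muleA -EFinM mulVf ?mul1e//.
by rewrite pnatr_eq0 -lt0n.
Qed.

End nonnegative_loss.

(** * Signed losses, split into positive and negative parts *)

Theorem corollary1 (R : realType) (m k : nat)
  (X : set (m.-tuple R)) (mX : measurable X)
  (p : m.-tuple R -> 'I_k.+3 * plabel k -> R)
  (d0 : measure_display) (Om0 : measurableType d0) (P0 : probability Om0 R)
  (T : {RV P0 >-> (m.-tuple R * ('I_k.+3 * plabel k))%type})
  (dT : has_density X p T)
  (ppl : candidate_contains_label X p)
  (hp : proper_ppl X p)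
  (d : measure_display) (Om : measurableType d) (P : probability Om R)
  (n : nat) (n0 : (0 < n)%N)
  (D : 'I_n -> {RV P >-> (m.-tuple R * plabel k)%type})
  (dD : forall i, has_density X (p_xs p) (D i))
  (iD : mutually_independent D)
  (f : m.-tuple R -> k.+3.-tuple R) (mf : measurable_fun X f)
  (L : k.+3.-tuple R -> 'I_k.+3 -> R)
  (mL : forall y, measurable_fun setT (L ^~ y))
  (hR : has_expectation P0 (fun w => L (f (T w).1) (T w).2.1)) :
  unbiased_estimator P
    (fun w => ppl_risk_estimator p f L (fun i => D i w))
    ('E_P0[fun w => L (f (T w).1) (T w).2.1])%E.
Proof.
pose Lp v y : R := Num.max (L v y) 0; pose Ln v y : R := Num.max (- L v y) 0.
have mLp y : measurable_fun setT (Lp ^~ y) by exact: (measurable_funrpos (mL y)).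
have mLn y : measurable_fun setT (Ln ^~ y) by exact: (measurable_funrneg (mL y)).
have Lp0 v y : 0 <= Lp v y by rewrite le_max lexx orbT.
have Ln0 v y : 0 <= Ln v y by rewrite le_max lexx orbT.
pose est (L' : k.+3.-tuple R -> 'I_k.+3 -> R) w :=
  ppl_risk_estimator p f L' (fun i => D i w).
(* The estimator is linear in the loss. In general [est Lp] and [est Ln] are not the positive and
   negative parts of [est L], since terms of both signs are averaged. *)
have estB : est L = est Lp \- est Ln.
  apply/funext => w; rewrite /est /ppl_risk_estimator /= -mulrBr -sumrB.
  congr (_ * _); apply: eq_bigr => i _; rewrite /ppl_loss -sumrB.
  apply: eq_bigr => j _; rewrite -mulrBr; congr (_ * _).
  exact: (esym (congr1 (@^~ (f (D i w).1)) (funrposBneg (L ^~ j)))).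
have mest (L' : k.+3.-tuple R -> 'I_k.+3 -> R) :
    (forall y, measurable_fun setT (L' ^~ y)) -> measurable_fun setT (est L').
  move=> mL'; apply: measurable_funM => //; apply: measurable_sum => i.
  exact: (measurable_ppl_lossT mX dT mf mL').
have est0 (L' : k.+3.-tuple R -> 'I_k.+3 -> R) :
    (forall v y, 0 <= L' v y) -> forall w, 0 <= est L' w.
  move=> L'0 w; rewrite mulr_ge0 ?invr_ge0// sumr_ge0// => i _.
  by have [DX _ _ _] := dD i; apply: (ppl_loss_ge0 _ dT) => //; exact: DX.
(* For the risk, in contrast, [Lp] and [Ln] evaluated at [f] do give the positive and negative parts
   of the integrand, so each part of the risk is the expectation of a nonnegative estimator. *)
have Ep : (\int[P0]_w ((EFin \o (fun w => L (f (T w).1) (T w).2.1))^\+ w) =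
    \int[P]_w (est Lp w)%:E)%E.
  by rewrite (ge0_expectation_ppl_risk_estimator mX dT hp mf mLp Lp0 dD n0) funerpos.
have En : (\int[P0]_w ((EFin \o (fun w => L (f (T w).1) (T w).2.1))^\- w) =
    \int[P]_w (est Ln w)%:E)%E.
  by rewrite (ge0_expectation_ppl_risk_estimator mX dT hp mf mLn Ln0 dD n0) funerneg.
(* Existence of the risk becomes finiteness of one of the two estimator expectations. *)
have [_ fin] := hR; rewrite Ep En in fin.
rewrite expectation.unlock integralE Ep En -/(est L) estB.
by apply: unbiased_estimatorB => //; [exact: mest|exact: mest|exact: est0|exact: est0].
Qed.
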